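(* Let $\widetilde{K}/k$ be a Galois extension of fields whose Galois group $G$ is isomorphic to the symmetric group $S_4$, let $G'$ be a subgroup of $G$ of order $3$, and let $K=\widetilde{K}^{G'}$ be the subfield of $\widetilde{K}$ fixed by $G'$ (so that $K/k$ is a separable extension of degree $8$). Then there exist two Hopf Galois structures $(H,\mu)$ and $(H',\mu')$ on $K/k$ which are not isomorphic as Hopf Galois structures, but whose underlying Hopf algebras $H$ and $H'$ are isomorphic as $k$-Hopf algebras.
   Context: Let $K/k$ be a finite extension of fields. A Hopf Galois structure on $K/k$ is a pair $(H,\mu)$, where $H$ is a finite (i.e. finite-dimensional) cocommutative $k$-Hopf algebra and $\mu: H\to \operatorname{End}_k(K)$ is a Hopf action of $H$ on $K$ (a $k$-linear map making $K$ a left $H$-module algebra) such that the induced map $K\otimes_k H\to \operatorname{End}_k(K)$, $x\otimes h\mapsto (y\mapsto x\cdot\mu(h)(y))$, is bijective. The Hopf algebra $H$ is called the underlying Hopf algebra of the structure. Two Hopf Galois structures $(H_1,\mu_1)$ and $(H_2,\mu_2)$ on $K/k$ are isomorphic if there exists an isomorphism of $k$-Hopf algebras $f:H_1\to H_2$ such that $\mu_2\circ f=\mu_1$. *)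

(* Defs.v *)
From HB Require Import structures.
From mathcomp Require Import all_boot all_order all_fingroup all_algebra.
From mathcomp Require Import all_solvable all_field.

Set Implicit Arguments.
Unset Strict Implicit.
Unset Printing Implicit Defensive.

Import GRing.Theory.
Local Open Scope ring_scope.

Section Tensor.

Variable F : fieldType.
Implicit Types T U V W : vectType F.

(* U \otimes V is modelled by coordinate matrices: the matrix unit (i, j)
   stands for (vbasis {:U})`_i \otimes (vbasis {:V})`_j. *)
Definition tens U V : vectType F := 'M[F]_(\dim {:U}, \dim {:V}).

Definition tensv U V (u : U) (v : V) : tens U V :=
  \matrix_(i, j) (coord (vbasis {:U}) i u * coord (vbasis {:V}) j v).

(* For f bilinear, this is the unique linear map on U \otimes V that sends
   u \otimes v to f u v: see tlift_linear, tlift_tensv and tlift_unique. It is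
   only applied to bilinear f below. *)
Definition tlift U V W (f : U -> V -> W) (t : tens U V) : W :=
  \sum_i \sum_j (t : 'M_(_, _)) i j *: f (vbasis {:U})`_i (vbasis {:V})`_j.

Lemma tlift_linear U V W (f : U -> V -> W) : linear (tlift f).
Proof.
move=> a s t; rewrite /tlift scaler_sumr -big_split; apply: eq_bigr => i _ /=.
rewrite scaler_sumr -big_split; apply: eq_bigr => j _ /=.
by rewrite !mxE scalerDl scalerA.
Qed.

Lemma linear_sumE U W (g : U -> W) (I : finType) (a : I -> F) (x : I -> U) :
  linear g -> g (\sum_i a i *: x i) = \sum_i a i *: g (x i).
Proof.
move=> lin_g.
pose G : {linear U -> W} := HB.pack g (GRing.isLinear.Build F U W *:%R g lin_g).
by rewrite -[g]/(G : U -> W) linear_sum; apply: eq_bigr => i _; rewrite linearZ.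
Qed.

Lemma tlift_tensv U V W (f : U -> V -> W) :
    (forall u, linear (f u)) -> (forall v, linear (f^~ v)) ->
  forall u v, tlift f (tensv u v) = f u v.
Proof.
move=> lin_r lin_l u v.
rewrite [in RHS](coord_vbasis (memvf u)) (linear_sumE _ _ (lin_l v)).
apply: eq_bigr => i _.
rewrite [in RHS](coord_vbasis (memvf v)) (linear_sumE _ _ (lin_r _)).
rewrite scaler_sumr; apply: eq_bigr => j _.
by rewrite scalerA /tensv mxE.
Qed.

Lemma tensv_basis U V (i : 'I_(\dim {:U})) (j : 'I_(\dim {:V})) :
  tensv (vbasis {:U})`_i (vbasis {:V})`_j = delta_mx i j :> 'M_(_, _).
Proof.
have freeU := basis_free (vbasisP {:U}); have freeV := basis_free (vbasisP {:V}).
apply/matrixP=> i' j'; rewrite !mxE !coord_free // -natrM mulnb.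
by rewrite [i == _]eq_sym [j == _]eq_sym.
Qed.

Lemma tens_span U V (t : tens U V) :
  t = \sum_i \sum_j
        (t : 'M_(_, _)) i j *: tensv (vbasis {:U})`_i (vbasis {:V})`_j.
Proof.
rewrite [LHS]matrix_sum_delta; apply: eq_bigr => i _; apply: eq_bigr => j _.
by rewrite tensv_basis.
Qed.

Lemma tlift_unique U V W (g : tens U V -> W) :
  linear g -> g =1 tlift (fun u v => g (tensv u v)).
Proof.
move=> lin_g t; rewrite {1}(tens_span t) /tlift.
pose G : {linear tens U V -> W} :=
  HB.pack g (GRing.isLinear.Build F (tens U V) W *:%R g lin_g).
rewrite -[g]/(G : _ -> W) linear_sum; apply: eq_bigr => i _.
by rewrite linear_sum; apply: eq_bigr => j _; rewrite linearZ.
Qed.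

Lemma tensv_linearr U V (u : U) : linear (@tensv U V u).
Proof.
by move=> a v v'; apply/matrixP=> i j; rewrite !mxE linearP mulrDr mulrCA.
Qed.

Lemma tensv_linearl U V (v : V) : linear (@tensv U V ^~ v).
Proof.
by move=> a u u'; apply/matrixP=> i j; rewrite !mxE linearP mulrDl mulrA.
Qed.

Lemma tlift_linearf T U V W (f : T -> U -> V -> W) (t : tens U V) :
  (forall u v, linear (fun x => f x u v)) -> linear (fun x => tlift (f x) t).
Proof.
move=> lin_f a x y; rewrite /tlift scaler_sumr -big_split.
apply: eq_bigr => i _ /=; rewrite scaler_sumr -big_split.
by apply: eq_bigr => j _ /=; rewrite lin_f scalerDr !scalerA mulrC.
Qed.

Definition tassoc U V W : tens (tens U V) W -> tens U (tens V W) :=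
  tlift (fun t w => tlift (fun u v => tensv u (tensv v w)) t).

Definition tswap U V : tens U V -> tens V U := tlift (fun u v => tensv v u).

Definition tmap U V U' V' (f : U -> U') (g : V -> V') :
    tens U V -> tens U' V' :=
  tlift (fun u v => tensv (f u) (g v)).

Definition tmul (A B : falgType F) (s t : tens A B) : tens A B :=
  tlift (fun a b => tlift (fun a' b' => tensv (a * a') (b * b')) t) s.

Lemma tassoc_tensv U V W (u : U) (v : V) (w : W) :
  tassoc (tensv (tensv u v) w) = tensv u (tensv v w).
Proof.
rewrite /tassoc tlift_tensv => [|t|w' a s t]; last by rewrite tlift_linear.
- rewrite tlift_tensv // => x a y z; last by rewrite tensv_linearl.
  by rewrite tensv_linearl tensv_linearr.
- by apply: tlift_linearf => u' v' a x y; rewrite !tensv_linearr.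
Qed.

Lemma tswap_tensv U V (u : U) (v : V) : tswap (tensv u v) = tensv v u.
Proof.
rewrite /tswap tlift_tensv // => x; [exact: tensv_linearl|exact: tensv_linearr].
Qed.

Lemma tmap_tensv U V U' V' (f : 'Hom(U, U')) (g : 'Hom(V, V')) u v :
  tmap f g (tensv u v) = tensv (f u) (g v).
Proof.
rewrite /tmap tlift_tensv // => x a y z.
  by rewrite linearP tensv_linearr.
by rewrite linearP tensv_linearl.
Qed.

Lemma tmul_tensv (A B : falgType F) (a a' : A) (b b' : B) :
  tmul (tensv a b) (tensv a' b') = tensv (a * a') (b * b').
Proof.
rewrite /tmul tlift_tensv => [|x|y].
- rewrite tlift_tensv // => x c y z.
    by rewrite mulrDr -scalerAr tensv_linearr.
  by rewrite mulrDr -scalerAr tensv_linearl.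
- by apply: tlift_linearf => u v c y z; rewrite mulrDl -scalerAl tensv_linearr.
- by apply: tlift_linearf => u v c x z; rewrite mulrDl -scalerAl tensv_linearl.
Qed.

End Tensor.

Section Hopf.

Variable F : fieldType.

(* Every finite-dimensional algebra over a field is canonically a falgType, and
   a Hopf algebra over a field is nonzero because its counit preserves 1. *)
Record hopfAlgebra := HopfAlgebra {
  hopf_alg :> falgType F;
  comul : 'Hom(hopf_alg, tens hopf_alg hopf_alg);
  counit : 'Hom(hopf_alg, F^o);
  antipode : 'End(hopf_alg);
  comulA : forall h,
    tassoc (tmap comul id (comul h)) = tmap id comul (comul h);
  counitl : forall h, tlift (fun a b => (counit a : F) *: b) (comul h) = h;
  counitr : forall h, tlift (fun a b => (counit b : F) *: a) (comul h) = h;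
  comul1 : comul 1 = tensv 1 1;
  comulM : forall g h, comul (g * h) = tmul (comul g) (comul h);
  counit1 : counit 1 = 1;
  counitM : forall g h, counit (g * h) = counit g * counit h;
  antipodel : forall h,
    tlift (fun a b => antipode a * b) (comul h) = (counit h : F)%:A;
  antipoder : forall h,
    tlift (fun a b => a * antipode b) (comul h) = (counit h : F)%:A
}.

Definition cocommutative (H : hopfAlgebra) :=
  forall h : H, tswap (comul H h) = comul H h.

Definition hopf_isomorphism (H1 H2 : hopfAlgebra) (f : 'AHom(H1, H2)) :=
  [/\ bijective f,
      forall h, comul H2 (f h) = tmap f f (comul H1 h),
      forall h, counit H2 (f h) = counit H1 h
    & forall h, antipode H2 (f h) = f (antipode H1 h)].

Definition hopf_isomorphic (H1 H2 : hopfAlgebra) :=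
  exists f : 'AHom(H1, H2), hopf_isomorphism f.

Definition hopf_action (H : hopfAlgebra) (A : falgType F)
    (mu : 'Hom(H, 'End(A))) :=
  [/\ mu 1 = \1%VF,
      forall g h, mu (g * h) = (mu g \o mu h)%VF,
      forall h, mu h 1 = (counit H h : F)%:A
    & forall h x y, mu h (x * y) = tlift (fun a b => mu a x * mu b y) (comul H h)].

(* K \otimes H -> End_F(K), x \otimes h |-> (y |-> x * mu h y) *)
Definition galois_map (H : hopfAlgebra) (K : fieldExtType F)
    (mu : 'Hom(H, 'End(K))) : tens K H -> 'End(K) :=
  tlift (fun x h => (amull x \o mu h)%VF).

Lemma galois_map_tensv (H : hopfAlgebra) (K : fieldExtType F)
    (mu : 'Hom(H, 'End(K))) x h y :
  galois_map mu (tensv x h) y = x * mu h y.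
Proof.
rewrite /galois_map tlift_tensv => [|u|v].
- by rewrite comp_lfunE lfunE.
- by move=> a g g'; rewrite linearP comp_lfunDr comp_lfunZr.
- by move=> a u u'; rewrite linearP comp_lfunDl comp_lfunZl.
Qed.

Record hopfGalois (K : fieldExtType F) := HopfGalois {
  hg_hopf : hopfAlgebra;
  hg_act : 'Hom(hg_hopf, 'End(K));
  hg_cocomm : cocommutative hg_hopf;
  hg_action : hopf_action hg_act;
  hg_galois : bijective (galois_map hg_act)
}.

Definition hopfGalois_isomorphic (K : fieldExtType F) (X1 X2 : hopfGalois K) :=
  exists2 f : 'AHom(hg_hopf X1, hg_hopf X2), hopf_isomorphism f &
    forall h, hg_act X2 (f h) = hg_act X1 h.

End Hopf.

(* Main.v *)
Require Import Defs.
From HB Require Import structures.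
From mathcomp Require Import all_boot all_order all_fingroup all_algebra.
From mathcomp Require Import all_solvable all_field.

(** Write G for the Galois group of L = Kt over k and K for the field fixed by
    G'. Two facts carry the proof.

    Hopf Galois structures from cocycles. Let G act by automorphisms on a
    finite group N. It then acts semilinearly on the group ring L[N], and the
    invariants H = L[N]^G form a cocommutative Hopf algebra over k, a descended
    form of L[N] ([inv_hopf]). Suppose that pi : G -> N is a cocycle for this
    action, is onto, and takes the value 1 exactly on G'. Then pi identifies
    the k-embeddings of K into L, that is the cosets g G', with the elements of
    N; let e_n be the embedding that n stands for. The formula
    (sum_n c_n n) x = sum_n c_n e_n(x) makes H act on K: the invariance of c
    keeps the value inside K, and the cocycle identity turns composition of
    embeddings into multiplication in N. By independence of characters and a
    count of dimensions this is a Hopf Galois structure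
    ([cocycle_structure]).

    Comparison. The Hopf algebra H depends on the action of G on N only, so two
    cocycles pi1, pi2 for one action give two structures with the same H. If f
    is an isomorphism between these structures, then independence of characters
    shows that the coefficient of f(c) at pi2(g) is the coefficient of c at
    pi1(g). Hence the bijection pi1(g) |-> pi2(g) of N commutes with the action
    of G ([cocycle_structure_iso]).

    For G = S_4, let N be the group of subsets of {0,1,2,3} modulo
    complementation, with symmetric difference as the law and the evident
    action; it is elementary abelian of order 8. Identify {0,1,2,3} with the
    field of four elements so that 0 is zero, and let w be one of its two
    primitive cube roots of unity. Then g |-> {0, w^2 g(0)} for g even and
    g |-> {w g(0)} for g odd is a cocycle onto N that is trivial exactly on the
    stabiliser of 0 in A_4. The two choices of w give two cocycles with the
    same kernel, and the bijection between them is not equivariant. Every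
    subgroup of order 3 of S_4 is conjugate to that stabiliser by Sylow's
    theorem, which reduces a general G' to this one. *)

Set Implicit Arguments.
Unset Strict Implicit.
Unset Printing Implicit Defensive.
Import GRing.Theory.
Local Open Scope ring_scope.

(** * Linear maps out of tensor products *)

HB.instance Definition _ (F : fieldType) (U V W : vectType F)
    (f : U -> V -> W) :=
  GRing.isLinear.Build F (tens U V) W *:%R (tlift f) (tlift_linear f).

HB.instance Definition _ (F : fieldType) (U V U' V' : vectType F)
    (f : U -> U') (g : V -> V') :=
  GRing.isLinear.Build F (tens U V) (tens U' V') *:%R (tmap f g)
    (tlift_linear _).

HB.instance Definition _ (F : fieldType) (U V W : vectType F) :=
  GRing.isLinear.Build F (tens (tens U V) W) (tens U (tens V W)) *:%R
    (@tassoc F U V W) (tlift_linear _).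

HB.instance Definition _ (F : fieldType) (U V : vectType F) :=
  GRing.isLinear.Build F (tens U V) (tens V U) *:%R (@tswap F U V)
    (tlift_linear _).

HB.instance Definition _ (F : fieldType) (H : hopfAlgebra F)
    (K : fieldExtType F) (f : 'Hom(H, 'End(K))) :=
  GRing.isLinear.Build F (tens K H) 'End(K) *:%R (galois_map f)
    (tlift_linear _).

Section TensorExtensionality.
Variables (F : fieldType) (U V W : vectType F).

Lemma dim_tens : \dim {: tens U V} = (\dim {: U} * \dim {: V})%N.
Proof. by rewrite dimvf. Qed.

Lemma tlift_ext (f g : U -> V -> W) :
  (forall u v, f u v = g u v) -> tlift f =1 tlift g.
Proof.
by move=> fg t; apply: eq_bigr => i _; apply: eq_bigr => j _; rewrite fg.
Qed.

Lemma tens_ext (f g : tens U V -> W) :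
    linear f -> linear g -> (forall u v, f (tensv u v) = g (tensv u v)) ->
  f =1 g.
Proof.
move=> lin_f lin_g fg t.
by rewrite (tlift_unique lin_f) (tlift_unique lin_g); apply: tlift_ext.
Qed.

End TensorExtensionality.

Lemma tmapE (F : fieldType) (U V U' V' : vectType F)
    (f : {linear U -> U'}) (g : {linear V -> V'}) u v :
  tmap f g (tensv u v) = tensv (f u) (g v).
Proof.
rewrite /tmap tlift_tensv // => x a y z.
  by rewrite linearP tensv_linearr.
by rewrite linearP tensv_linearl.
Qed.

Lemma bijective_of_dim (F : fieldType) (U V : vectType F)
    (f : {linear U -> V}) :
  injective f -> \dim {: U} = \dim {: V} -> bijective f.
Proof.
move=> injf dimUV; pose lf : 'Hom(U, V) := linfun f.
have lfE : lf =1 f by exact: lfunE.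
have ker0 : lker lf == 0%VS by apply/lker0P=> x y; rewrite !lfE; apply: injf.
have im : limg lf = fullv.
  apply/eqP; rewrite eqEdim subvf /= -dimUV limg_dim_eq //.
  by rewrite (eqP ker0) capv0.
exists (lf^-1)%VF => x; first by rewrite -lfE lker0_lfunK.
by rewrite -lfE limg_lfunVK // im memvf.
Qed.

(** * Descent for equivariant functions *)

Section Equivariant.
Variables (k : fieldType) (L : splittingFieldType k).
Local Notation gal := (gal_of {:L}%VS).

Lemma galME (g h : gal) (x : L) : (g * h)%g x = h (g x).
Proof. by rewrite galM ?memvf. Qed.

Section OneSet.
Variables (Omega : finType) (to : {action gal &-> Omega}).

(** The action of the product g * h on L applies g first, so the group acts on
    the right throughout; the exponent -1 makes the invariants of [translate]
    the functions with c (w . g) = g (c w). *)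
Definition translate (g : gal) (c : {ffun Omega -> L}) : {ffun Omega -> L} :=
  [ffun w => g (c (to w g^-1%g))].

Lemma translate_linear g : linear (translate g).
Proof. by move=> a c d; apply/ffunP=> w; rewrite !ffunE linearP. Qed.

HB.instance Definition _ g :=
  GRing.isLinear.Build k {ffun Omega -> L} {ffun Omega -> L} *:%R
    (translate g) (translate_linear g).

Definition equivariant : {vspace {ffun Omega -> L}} :=
  (\bigcap_g fixedSpace (linfun (translate g)))%VS.

Lemma equivariantP (c : {ffun Omega -> L}) :
  reflect (forall w g, c (to w g) = g (c w)) (c \in equivariant).
Proof.
apply: (iffP subv_bigcapP) => [cP w g | cP g _].
  have /fixedSpaceP := cP g isT; rewrite lfunE /= => {1}<-.
  by rewrite ffunE actK.
apply/fixedSpaceP; rewrite lfunE /=; apply/ffunP=> w.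
by rewrite ffunE -cP actKV.
Qed.

(** Test the linear form x against the orbit sum of a times the delta function
    at w, which is equivariant. The result is sum_g x (w . g) g(a), and
    independence of characters kills its coefficients. *)
Lemma equivariant_annihilator (x : Omega -> L) :
    (forall c : {ffun Omega -> L}, c \in equivariant -> \sum_w x w * c w = 0) ->
  forall w, x w = 0.
Proof.
move=> x0 w.
suffices /(_ 1%g isT) : forall g : gal, predT g -> x (to w g) = 0.
  by rewrite act1.
apply: gal_independent => a _.
pose c := [ffun v => \sum_(g : gal | to w g == v) g a].
rewrite -[RHS](x0 c); last first.
  apply/equivariantP=> v h.
  rewrite !ffunE rmorph_sum (reindex_inj (mulIg h)) /=.
  by apply: eq_big => g; rewrite actM ?galME // (inj_eq (act_inj _ _)).
rewrite (partition_big (to w) predT) //=; apply: eq_bigr => v _.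
by rewrite ffunE mulr_sumr; apply: eq_bigr => g /eqP->.
Qed.

Hypothesis galL : galois 1 {:L}.

Lemma gal_fixed_scalar (x : L) :
  (forall g : gal, g x = x) -> {a : k | x = a%:A}.
Proof.
move=> fix_x; suffices: x \in 1%VS by move/vlineP/sig_eqW.
by rewrite -(galois_fixedField galL); apply/fixedFieldP; rewrite ?memvf.
Qed.

(** Families of equivariant functions that are independent over k stay
    independent over L: multiply a relation by a and sum it over its conjugates
    to get relations with the coefficients Tr (a x_i) in k, which vanish for
    every a; so the x_i vanish. *)
Lemma equivariant_free n (u : 'I_n -> {ffun Omega -> L}) (x : 'I_n -> L) :
    (forall i, u i \in equivariant) ->
    (forall a : 'I_n -> k, \sum_i a i *: u i = 0 -> forall i, a i = 0) ->
    (forall w, \sum_i x i * u i w = 0) ->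
  forall i, x i = 0.
Proof.
move=> equiv_u free_u x0 i.
suffices /(_ 1%g isT) : forall g : gal, predT g -> g (x i) = 0.
  by rewrite gal_id.
apply: gal_independent => a _.
have trP j : {s : k | \sum_(g : gal) g (x j) * g a = s%:A}.
  apply: gal_fixed_scalar => h.
  rewrite rmorph_sum [RHS](reindex_inj (mulIg h)) /=.
  by apply: eq_bigr => g _; rewrite rmorphM !galME.
pose s j := sval (trP j).
have sE j : \sum_(g : gal) g (x j) * g a = (s j)%:A := svalP (trP j).
rewrite sE (free_u s) ?scale0r //; apply/ffunP=> w.
rewrite sum_ffunE ffunE.
rewrite -[RHS](_ :
  \sum_(g : gal) g (a * \sum_j x j * u j (to w g^-1%g)) = 0); last first.
  by apply: big1 => g _; rewrite x0 mulr0 rmorph0.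
under [RHS]eq_bigr => g _ do rewrite mulr_sumr rmorph_sum /=.
rewrite [RHS]exchange_big; apply: eq_bigr => j _.
rewrite ffunE -[LHS]mulr_algl -sE mulr_suml; apply: eq_bigr => g _.
have /equivariantP cP := equiv_u j.
by rewrite !rmorphM /= -cP actKV mulrA (mulrC (g a)).
Qed.

(** The matrix of values of a k-basis has independent rows by
    [equivariant_free] and independent columns by [equivariant_annihilator], so
    it is square. *)
Lemma dim_equivariant : \dim equivariant = #|Omega|.
Proof.
pose b := vbasis equivariant; have freeb := basis_free (vbasisP equivariant).
pose M : 'M[L]_(_, _) :=
  \matrix_(i < \dim equivariant, j < #|Omega|) b`_i (enum_val j).
have sumM (x : Omega -> L) i :
    \sum_(j < #|Omega|) x (enum_val j) * M i j = \sum_w x w * b`_i w.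
  rewrite [RHS](reindex _ (onW_bij _ (enum_val_bij Omega))).
  by apply: eq_bigr => j _; rewrite mxE.
have /eqnP<- : row_free M.
  apply: inj_row_free => v vM0; apply/rowP=> i; rewrite mxE.
  apply: (@equivariant_free _ (fun i => b`_i)) i => [i | a | w].
  - by rewrite vbasis_mem ?mem_nth ?size_tuple.
  - exact: freeP.
  - have /rowP/(_ (enum_rank w)) := vM0; rewrite !mxE => {2}<-.
    by apply: eq_bigr => i _; rewrite mxE enum_rankK.
rewrite -mxrank_tr; apply/eqP; change (row_free M^T).
apply: inj_row_free => v vM0; apply/rowP=> j; rewrite mxE.
pose x w := v 0 (enum_rank w).
rewrite -[j]enum_valK -/(x _); apply: equivariant_annihilator => c cE.
have xb (i : 'I_(\dim equivariant)) : \sum_w x w * b`_i w = 0.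
  rewrite -sumM; have /rowP/(_ i) := vM0; rewrite !mxE => {2}<-.
  by apply: eq_bigr => l _; rewrite /x enum_valK !mxE.
rewrite (coord_vbasis cE) -/b.
under eq_bigr => w _ do rewrite sum_ffunE mulr_sumr.
rewrite exchange_big big1 // => i _.
under eq_bigr => w _ do rewrite ffunE -scalerAr.
by rewrite -scaler_sumr xb scaler0.
Qed.

End OneSet.
End Equivariant.

(** * Descent for tensor products *)

Section TensorCoefficients.
Variables (k : fieldType) (L : splittingFieldType k) (A B : finType).
Local Notation gal := (gal_of {:L}%VS).
Variables (U V : vectType k).
Variables (cU : 'Hom(U, {ffun A -> L})) (cV : 'Hom(V, {ffun B -> L})).

(** The functions on A * B that tensors of functions on A and on B represent.
    Every identity between tensors below is checked on these coefficients. *)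
Definition tcoef : 'Hom(tens U V, {ffun A * B -> L}) :=
  linfun (tlift (fun u v => [ffun w => cU u w.1 * cV v w.2])).

Lemma tcoefE t : tcoef t =
  tlift (fun u v => [ffun w => cU u w.1 * cV v w.2]) t.
Proof. exact: lfunE. Qed.

Lemma tcoef_tensv u v a b : tcoef (tensv u v) (a, b) = cU u a * cV v b.
Proof.
rewrite tcoefE tlift_tensv ?ffunE // => x c y z; apply/ffunP=> w.
  by rewrite !(ffunE, linearP) mulrDr -scalerAr.
by rewrite !(ffunE, linearP) mulrDl -scalerAl.
Qed.

(** A tensor that vanishes on A * B gives, for each b, an L-linear relation
    between the functions of a k-basis of U; [equivariant_free] makes it
    trivial. Equivariance is asked of the left factor alone, so that the right
    one can itself be a tensor product. *)
Lemma tcoef_inj (to : {action gal &-> A}) :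
    galois 1 {:L} -> (forall u, cU u \in equivariant to) ->
    injective cU -> injective cV ->
  injective tcoef.
Proof.
move=> galL equiv_U injU injV; apply: raddf_inj => t t0.
pose u := vbasis {: U}; pose v := vbasis {: V}.
have /freeP freeu : free u := basis_free (vbasisP _).
have /freeP freev : free v := basis_free (vbasisP _).
pose y (i : 'I_(\dim {: U})) : V := \sum_j (t : 'M_(_, _)) i j *: v`_j.
suffices y0 i : y i = 0.
  by apply/matrixP=> i j; rewrite mxE; exact: (freev _ (y0 i)).
apply: injV; rewrite linear0; apply/ffunP=> b; rewrite ffunE.
apply: (equivariant_free galL (u := fun i => cU u`_i)
         (x := fun i => cV (y i) b)) i => [// | a au0 | a].
  apply: freeu; apply: injU; rewrite linear0 linear_sum -[RHS]au0.
  by apply: eq_bigr => i _; rewrite linearZ.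
have /ffunP/(_ (a, b)) := t0; rewrite /= tcoefE sum_ffunE !ffunE => {2}<-.
apply: eq_bigr => i _; rewrite sum_ffunE linear_sum sum_ffunE mulr_suml.
by apply: eq_bigr => j _; rewrite linearZ !ffunE -scalerAl mulrC.
Qed.

End TensorCoefficients.

Section TensorDescent.
Variables (k : fieldType) (L : splittingFieldType k) (A B : finType).
Local Notation gal := (gal_of {:L}%VS).
Variables (toA : {action gal &-> A}) (toB : {action gal &-> B}).

Definition prod_to (w : A * B) (g : gal) := (toA w.1 g, toB w.2 g).

Lemma prod_to1 : prod_to^~ 1%g =1 id.
Proof. by case=> a b; rewrite /prod_to !act1. Qed.

Lemma prod_toM w : act_morph prod_to w.
Proof. by move=> g h; rewrite /prod_to !actM. Qed.

Definition prod_act := TotalAction prod_to1 prod_toM.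

Variables (U V : vectType k).
Variables (cU : 'Hom(U, {ffun A -> L})) (cV : 'Hom(V, {ffun B -> L})).
Hypotheses (galL : galois 1 {:L}).
Hypotheses (injU : injective cU) (injV : injective cV).
Hypotheses (imU : limg cU = equivariant toA) (imV : limg cV = equivariant toB).

(** Surjectivity onto equivariant functions comes from injectivity, since the
    dimensions #|A| * #|B| and #|A * B| agree. *)
Lemma limg_tcoef : limg (tcoef cU cV) = equivariant prod_act.
Proof.
have eqU u w g : cU u (toA w g) = g (cU u w).
  by move: w g; apply/equivariantP; rewrite -imU memv_img ?memvf.
have eqV v w g : cV v (toB w g) = g (cV v w).
  by move: w g; apply/equivariantP; rewrite -imV memv_img ?memvf.
have inj_t : injective (tcoef cU cV).
  by apply: (tcoef_inj galL (to := toA)) => // u; apply/equivariantP.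
apply/eqP; rewrite eqEdim; apply/andP; split.
  apply/subvP=> _ /memv_imgP[t _ ->]; apply/equivariantP=> -[a b] g.
  rewrite !tcoefE /tlift !sum_ffunE rmorph_sum; apply: eq_bigr => i _.
  rewrite !sum_ffunE rmorph_sum; apply: eq_bigr => j _.
  by rewrite !ffunE /= eqU eqV linearZ /= rmorphM.
rewrite dim_equivariant // card_prod limg_dim_eq; last first.
  by move/lker0P/eqP: inj_t => ->; rewrite capv0.
rewrite dim_tens -(dim_equivariant toA galL) -(dim_equivariant toB galL).
rewrite -imU -imV !limg_dim_eq //.
  by move/lker0P/eqP: injV => ->; rewrite capv0.
by move/lker0P/eqP: injU => ->; rewrite capv0.
Qed.

End TensorDescent.

(** * Regular cocycles *)

Section RegularCocycle.
Variables (gT N : finGroupType) (to : {action gT &-> N}).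

Definition acts_by_automorphisms :=
  forall g, {morph to^~ g : m n / (m * n)%g}.

Hypothesis toM : acts_by_automorphisms.

Lemma autact1 g : to 1%g g = 1%g.
Proof. by apply: (mulgI (to 1%g g)); rewrite -toM !mulg1. Qed.

Lemma autactV n g : to n^-1%g g = (to n g)^-1%g.
Proof. by apply: (mulgI (to n g)); rewrite -toM !mulgV autact1. Qed.

Variable G' : {group gT}.

(** With products read from left to right, [cocycleM] is the usual identity
    pi (g o h) = pi g * g (pi h). The other two fields say that pi induces a
    bijection from the cosets g o G' onto N, as [cocycle_eq] spells out. *)
Record regular_cocycle := RegularCocycle {
  cocycle :> gT -> N;
  cocycleM : forall g h, cocycle (h * g)%g = (cocycle g * to (cocycle h) g)%g;
  cocycle_surj : forall n, exists g, cocycle g == n;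
  cocycle_eq1 : forall g, (cocycle g == 1%g) = (g \in G')
}.

Variable pi : regular_cocycle.

Lemma cocycle_eq g h : (pi (h * g)%g == pi g) = (h \in G').
Proof.
rewrite cocycleM -{2}[pi g]mulg1 (inj_eq (mulgI _)) -{1}(autact1 g).
by rewrite (inj_eq (act_inj _ _)) cocycle_eq1.
Qed.

Lemma card_cocycle : #|[set: gT]| = (#|N| * #|G'|)%N.
Proof.
rewrite -sum1_card (partition_big pi predT) //= -sum_nat_const.
apply: eq_bigr => n _; have [g /eqP gn] := cocycle_surj pi n.
rewrite -sum1_card (reindex_inj (mulIg g)) /=; apply: eq_bigl => h.
by rewrite inE -gn cocycle_eq.
Qed.

End RegularCocycle.

Section Pullback.
Variables (gT hT N : finGroupType) (f : gT -> hT).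
Hypothesis fM : {morph f : g h / (g * h)%g}.
Variable to : {action hT &-> N}.

Definition pull_to n g := to n (f g).

Lemma pull_to1 : pull_to^~ 1%g =1 id.
Proof.
have f1 : f 1%g = 1%g by apply: (mulgI (f 1%g)); rewrite -fM !mulg1.
by move=> n; rewrite /pull_to f1 act1.
Qed.

Lemma pull_toM n : act_morph pull_to n.
Proof. by move=> g h; rewrite /pull_to fM actM. Qed.

Definition pull_act := TotalAction pull_to1 pull_toM.

Lemma pull_automorphisms :
  acts_by_automorphisms to -> acts_by_automorphisms pull_act.
Proof. by move=> toM g; apply: toM. Qed.

Variables (C : {group hT}) (G' : {group gT}).
Hypotheses (f_surj : forall p, exists g, f g = p).
Hypotheses (f_mem : forall g, (f g \in C) = (g \in G')).
Variable pi : regular_cocycle to C.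

Lemma pull_cocycleM g h :
  pi (f (h * g)%g) = (pi (f g) * pull_act (pi (f h)) g)%g.
Proof. by rewrite fM cocycleM. Qed.

Lemma pull_cocycle_surj n : exists g, pi (f g) == n.
Proof.
have [p pn] := cocycle_surj pi n; have [g gp] := f_surj p.
by exists g; rewrite gp.
Qed.

Lemma pull_cocycle_eq1 g : (pi (f g) == 1%g) = (g \in G').
Proof. by rewrite cocycle_eq1 f_mem. Qed.

Definition pull_cocycle : regular_cocycle pull_act G' :=
  RegularCocycle pull_cocycleM pull_cocycle_surj pull_cocycle_eq1.

End Pullback.

(** * The ring of invariants of a group ring *)

Section GroupRing.
Variables (k : fieldType) (L : splittingFieldType k) (N : finGroupType).
Local Notation gal := (gal_of {:L}%VS).
Implicit Types c d e : {ffun N -> L}.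

Definition conv c d : {ffun N -> L} :=
  [ffun p => \sum_m c m * d (m^-1 * p)%g].

Definition dirac (n : N) : {ffun N -> L} := [ffun p => (p == n)%:R].

Lemma convA : associative conv.
Proof.
move=> c d e; apply/ffunP=> p; rewrite !ffunE.
under eq_bigr => m _ do rewrite ffunE mulr_sumr.
under [RHS]eq_bigr => q _ do rewrite ffunE mulr_suml.
rewrite [RHS]exchange_big; apply: eq_bigr => m _ /=.
rewrite [RHS](reindex_inj (mulgI m)); apply: eq_bigr => q _ /=.
by rewrite mulKg invMg -!mulgA mulrA.
Qed.

Lemma conv1l : left_id (dirac 1) conv.
Proof.
move=> c; apply/ffunP=> p; rewrite ffunE (bigD1 1%g) //= ffunE eqxx mul1r.
rewrite invg1 mul1g big1 ?addr0 // => m /negbTE m1.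
by rewrite ffunE m1 mul0r.
Qed.

Lemma conv1r : right_id (dirac 1) conv.
Proof.
move=> c; apply/ffunP=> p; rewrite ffunE (bigD1 p) //= ffunE mulVg eqxx mulr1.
rewrite big1 ?addr0 // => m mp.
by rewrite ffunE -eq_mulVg1 (negbTE mp) mulr0.
Qed.

Lemma convDl : left_distributive conv +%R.
Proof.
move=> c d e; apply/ffunP=> p; rewrite !ffunE -big_split; apply: eq_bigr => m _.
by rewrite ffunE mulrDl.
Qed.

Lemma convDr : right_distributive conv +%R.
Proof.
move=> c d e; apply/ffunP=> p; rewrite !ffunE -big_split; apply: eq_bigr => m _.
by rewrite ffunE mulrDr.
Qed.

Lemma convZl (a : k) c d : a *: conv c d = conv (a *: c) d.
Proof.
apply/ffunP=> p; rewrite !ffunE scaler_sumr; apply: eq_bigr => m _.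
by rewrite ffunE scalerAl.
Qed.

Lemma convZr (a : k) c d : a *: conv c d = conv c (a *: d).
Proof.
apply/ffunP=> p; rewrite !ffunE scaler_sumr; apply: eq_bigr => m _.
by rewrite ffunE scalerAr.
Qed.

Section InvariantGroupRing.
Variables (to : {action gal &-> N}) (toM : acts_by_automorphisms to).

(** This is where the group has to act on N by automorphisms. *)
Lemma conv_equivariant c d :
  c \in equivariant to -> d \in equivariant to -> conv c d \in equivariant to.
Proof.
move=> /equivariantP cP /equivariantP dP; apply/equivariantP=> p g.
rewrite !ffunE (reindex_inj (act_inj to g)) rmorph_sum; apply: eq_bigr => m _.
by rewrite -(autactV toM) -toM cP dP /= rmorphM.
Qed.

Lemma dirac1_equivariant : dirac 1 \in equivariant to.
Proof.
apply/equivariantP=> p g; rewrite !ffunE rmorph_nat.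
by rewrite -{1}(autact1 toM g) (inj_eq (act_inj _ _)).
Qed.

(** The hypothesis is an argument so that the ring structure below, which
    depends on it, can be attached to this type. *)
Definition inv_ring (autP : acts_by_automorphisms to) :=
  subvs_of (equivariant to).
Local Notation H := (inv_ring toM).
HB.instance Definition _ := Vector.copy H (subvs_of (equivariant to)).

Definition coefs : 'Hom(H, {ffun N -> L}) := linfun vsval.

Lemma coefsE h : coefs h = vsval h. Proof. exact: lfunE. Qed.

Definition hone : H := Subvs dirac1_equivariant.
Definition hmul (g h : H) : H :=
  Subvs (conv_equivariant (subvsP g) (subvsP h)).

Lemma hmulA : associative hmul.
Proof. by move=> x y z; apply/val_inj/convA. Qed.
Lemma hmul1l : left_id hone hmul.
Proof. by move=> x; apply/val_inj/conv1l. Qed.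
Lemma hmul1r : right_id hone hmul.
Proof. by move=> x; apply/val_inj/conv1r. Qed.
Lemma hmulDl : left_distributive hmul +%R.
Proof. by move=> x y z; apply/val_inj/convDl. Qed.
Lemma hmulDr : right_distributive hmul +%R.
Proof. by move=> x y z; apply/val_inj/convDr. Qed.
Lemma hone_neq0 : hone != 0.
Proof.
apply/eqP=> /(congr1 (fun h : H => vsval h 1%g)) /eqP.
by rewrite /= !ffunE eqxx oner_eq0.
Qed.
HB.instance Definition _ := GRing.Zmodule_isNzRing.Build H
  hmulA hmul1l hmul1r hmulDl hmulDr hone_neq0.

Lemma hmulZl (a : k) (x y : H) : a *: (x * y) = (a *: x) * y.
Proof. exact/val_inj/convZl. Qed.
HB.instance Definition _ := GRing.Lmodule_isLalgebra.Build k H hmulZl.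
Lemma hmulZr (a : k) (x y : H) : a *: (x * y) = x * (a *: y).
Proof. exact/val_inj/convZr. Qed.
HB.instance Definition _ := GRing.Lalgebra_isAlgebra.Build k H hmulZr.
HB.instance Definition _ := Algebra_isFalgebra.Build k H.

Lemma coefs1 n : coefs 1 n = (n == 1%g)%:R.
Proof. by rewrite coefsE ffunE. Qed.

Lemma coefsM (x y : H) p :
  coefs (x * y) p = \sum_m coefs x m * coefs y (m^-1 * p)%g.
Proof. by rewrite !coefsE ffunE. Qed.

Lemma coefs_inj : injective coefs.
Proof. by move=> x y; rewrite !coefsE; apply: val_inj. Qed.

Lemma coefs_act (h : H) n g : coefs h (to n g) = g (coefs h n).
Proof. by rewrite coefsE; move: n g; apply/equivariantP/subvsP. Qed.

Lemma coefs_lift c : c \in equivariant to -> coefs (vsproj _ c : H) = c.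
Proof. by rewrite coefsE; apply: vsprojK. Qed.

Lemma limg_coefs : limg coefs = equivariant to.
Proof.
apply/vspaceP=> c; apply/memv_imgP/idP=> [[h _ ->] | /coefs_lift<-].
  by rewrite coefsE subvsP.
by exists (vsproj _ c : H); rewrite ?memvf.
Qed.
End InvariantGroupRing.
End GroupRing.

(** * Its Hopf algebra structure *)

Section HopfStructure.
Variables (k : fieldType) (L : splittingFieldType k) (N : finGroupType).
Local Notation gal := (gal_of {:L}%VS).
Variables (to : {action gal &-> N}) (toM : acts_by_automorphisms to).
Hypothesis galL : galois 1 {:L}.
Local Notation H := (inv_ring toM).
Local Notation cf := (coefs toM).
Local Notation cf2 := (tcoef cf cf).

Lemma coefs2_inj : injective cf2.
Proof.
apply: (tcoef_inj galL (to := to)); try exact: coefs_inj.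
by move=> h; rewrite -limg_coefs memv_img ?memvf.
Qed.

Lemma limg_coefs2 : limg cf2 = equivariant (prod_act to to).
Proof. by apply: limg_tcoef; rewrite ?limg_coefs //; apply: coefs_inj. Qed.

(** The comultiplication of the group ring sends n to the tensor of n with
    itself. *)
Definition diagonal (c : {ffun N -> L}) : {ffun N * N -> L} :=
  [ffun w => (w.1 == w.2)%:R * c w.1].

Lemma diagonal_linear : linear diagonal.
Proof.
move=> a c d; apply/ffunP=> w.
by rewrite !ffunE mulrDr scalerAr.
Qed.
HB.instance Definition _ :=
  GRing.isLinear.Build k {ffun N -> L} {ffun N * N -> L} *:%R
    diagonal diagonal_linear.

(** By [limg_coefs2] the diagonal function comes from a tensor over k. *)
Definition hcomul : 'Hom(H, tens H H) := (cf2^-1 \o linfun diagonal \o cf)%VF.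

Lemma hcomulE h m n : cf2 (hcomul h) (m, n) = (m == n)%:R * cf h m.
Proof.
rewrite !comp_lfunE [linfun diagonal _]lfunE /=.
rewrite limg_lfunVK ?ffunE // limg_coefs2.
apply/equivariantP=> -[p q] g; rewrite !ffunE /= (inj_eq (act_inj _ _)).
by rewrite coefs_act rmorphM rmorph_nat.
Qed.

Definition total (c : {ffun N -> L}) : L := \sum_n c n.

Lemma total_linear : linear total.
Proof.
move=> a c d; rewrite /total scaler_sumr -big_split; apply: eq_bigr => n _.
by rewrite !ffunE.
Qed.
HB.instance Definition _ :=
  GRing.isLinear.Build k {ffun N -> L} L *:%R total total_linear.

Definition scalar (a : k^o) : L := (a : k)%:A.

Lemma scalar_linear : linear scalar.
Proof. by move=> a b c; rewrite /scalar scalerDl -scalerA. Qed.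
HB.instance Definition _ :=
  GRing.isLinear.Build k k^o L *:%R scalar scalar_linear.

(** The sum of the coefficients is fixed by the Galois group, so it is a scalar
    of k. *)
Definition hcounit : 'Hom(H, k^o) :=
  ((linfun scalar)^-1 \o linfun total \o cf)%VF.

Lemma hcounitE h : (hcounit h : k)%:A = \sum_n cf h n.
Proof.
have [g | a ha] := gal_fixed_scalar galL (x := \sum_n cf h n).
  rewrite rmorph_sum [RHS](reindex_inj (act_inj to g)); apply: eq_bigr => n _.
  by rewrite coefs_act.
rewrite ha !comp_lfunE [linfun total _]lfunE /= /total ha.
have -> : a%:A = linfun scalar a by rewrite lfunE.
rewrite -[LHS]/(scalar _) -[LHS]lfunE.
by rewrite limg_lfunVK ?memv_img ?memvf.
Qed.

Definition reversal (c : {ffun N -> L}) : {ffun N -> L} := [ffun n => c n^-1%g].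

Lemma reversal_linear : linear reversal.
Proof. by move=> a c d; apply/ffunP=> n; rewrite !ffunE. Qed.
HB.instance Definition _ :=
  GRing.isLinear.Build k {ffun N -> L} {ffun N -> L} *:%R
    reversal reversal_linear.

Definition hantipode : 'End(H) :=
  (linfun (vsproj (equivariant to)) \o linfun reversal \o cf)%VF.

Lemma hantipodeE h n : cf (hantipode h) n = cf h n^-1%g.
Proof.
rewrite !comp_lfunE [linfun (vsproj _) _]lfunE [linfun reversal _]lfunE /=.
rewrite coefs_lift ?ffunE //; apply/equivariantP=> p g.
by rewrite !ffunE -autactV // coefs_act.
Qed.

Lemma coefs2_tensv u v a b : cf2 (tensv u v) (a, b) = cf u a * cf v b.
Proof. exact: tcoef_tensv. Qed.

Lemma hcomulA h :
  tassoc (tmap hcomul id (hcomul h)) = tmap id hcomul (hcomul h).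
Proof.
have inj3 : injective (tcoef cf cf2).
  apply: (tcoef_inj galL (to := to)); [|exact: coefs_inj|exact: coefs2_inj].
  by move=> u; rewrite -limg_coefs memv_img ?memvf.
have assocE a b c v :
    (fun s => tcoef cf cf2 (tassoc (tensv s v)) (a, (b, c))) =1
    (fun s => cf2 s (a, b) * cf v c).
  apply: tens_ext => [x s t|x s t|u w].
  - by rewrite tensv_linearl !(linearP, ffunE).
  - by rewrite !(linearP, ffunE) mulrDl -scalerAl.
  - by rewrite tassoc_tensv !tcoef_tensv mulrA.
have lhsE a b c :
    (fun t => tcoef cf cf2 (tassoc (tmap hcomul id t)) (a, (b, c))) =1
    (fun t => (a == b)%:R * cf2 t (a, c)).
  apply: tens_ext => [x s t|x s t|u w].
  - by rewrite !(linearP, ffunE).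
  - by rewrite !(linearP, ffunE) mulrDr -scalerAr.
  - by rewrite (tmapE hcomul idfun) /= assocE hcomulE coefs2_tensv mulrA.
have rhsE a b c : (fun t => tcoef cf cf2 (tmap id hcomul t) (a, (b, c))) =1
    (fun t => (b == c)%:R * cf2 t (a, b)).
  apply: tens_ext => [x s t|x s t|u w].
  - by rewrite !(linearP, ffunE).
  - by rewrite !(linearP, ffunE) mulrDr -scalerAr.
  - by rewrite (tmapE idfun hcomul) /= coefs2_tensv tcoef_tensv hcomulE mulrCA.
apply: inj3; apply/ffunP=> -[a [b c]].
rewrite lhsE rhsE !hcomulE.
by case: (eqVneq a b) => [->|]; rewrite ?(mul1r, mul0r, mulr0).
Qed.

Lemma hcounitl h : tlift (fun a b => (hcounit a : k) *: b) (hcomul h) = h.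
Proof.
have E n : (fun t => cf (tlift (fun a b => (hcounit a : k) *: b) t) n) =1
    (fun t => \sum_m cf2 t (m, n)).
  apply: tens_ext => [x s t|x s t|u w].
  - by rewrite !(linearP, ffunE).
  - rewrite scaler_sumr -big_split; apply: eq_bigr => m _.
    by rewrite !(linearP, ffunE).
  rewrite tlift_tensv => [|u' x s t|v x s t].
  - under [RHS]eq_bigr => m _ do rewrite coefs2_tensv.
    by rewrite -mulr_suml -hcounitE mulr_algl linearZ ffunE.
  - by rewrite scalerDr !scalerA mulrC.
  - by rewrite linearP scalerDl scalerA.
apply: (@coefs_inj _ _ _ _ toM); apply/ffunP=> n.
rewrite E (bigD1 n) //= hcomulE eqxx mul1r big1 ?addr0 // => m /negbTE mn.
by rewrite hcomulE mn mul0r.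
Qed.

Lemma hcounitr h : tlift (fun a b => (hcounit b : k) *: a) (hcomul h) = h.
Proof.
have E n : (fun t => cf (tlift (fun a b => (hcounit b : k) *: a) t) n) =1
    (fun t => \sum_m cf2 t (n, m)).
  apply: tens_ext => [x s t|x s t|u w].
  - by rewrite !(linearP, ffunE).
  - rewrite scaler_sumr -big_split; apply: eq_bigr => m _.
    by rewrite !(linearP, ffunE).
  rewrite tlift_tensv => [|u' x s t|v x s t].
  - under [RHS]eq_bigr => m _ do rewrite coefs2_tensv.
    by rewrite -mulr_sumr -hcounitE mulr_algr linearZ ffunE.
  - by rewrite linearP scalerDl scalerA.
  - by rewrite scalerDr !scalerA mulrC.
apply: (@coefs_inj _ _ _ _ toM); apply/ffunP=> n.
rewrite E (bigD1 n) //= hcomulE eqxx mul1r big1 ?addr0 // => m mn.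
by rewrite hcomulE eq_sym (negbTE mn) mul0r.
Qed.

Lemma hcomul1 : hcomul 1 = tensv 1 1.
Proof.
apply: coefs2_inj; apply/ffunP=> -[m n].
rewrite hcomulE coefs2_tensv !coefs1 -!natrM !mulnb.
have [->|mn] := eqVneq m n; first by rewrite andbb.
have [m1|_] := eqVneq m 1%g; have [n1|_] := eqVneq n 1%g => //.
by rewrite m1 n1 eqxx in mn.
Qed.

Lemma coefs2_tmul s t m n : cf2 (tmul s t) (m, n) =
  \sum_a \sum_b cf2 s (a, b) * cf2 t (a^-1 * m, b^-1 * n)%g.
Proof.
move: s; apply: tens_ext => [x s s'|x s s'|u v].
- by rewrite /tmul !(linearP, ffunE).
- rewrite scaler_sumr -big_split; apply: eq_bigr => a _ /=.
  rewrite scaler_sumr -big_split; apply: eq_bigr => b _ /=.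
  by rewrite !(linearP, ffunE) mulrDl scalerAl.
have linr (u' v' : H) : linear (fun t : tens H H => tmul (tensv u' v') t).
  by apply: tlift_linearf => a b; apply: tlift_linear.
move: t; apply: tens_ext => [x s s'|x s s'|u' v'].
- by rewrite linr !(linearP, ffunE).
- rewrite scaler_sumr -big_split; apply: eq_bigr => a _ /=.
  rewrite scaler_sumr -big_split; apply: eq_bigr => b _ /=.
  by rewrite !(linearP, ffunE) mulrDr scalerAr.
rewrite tmul_tensv coefs2_tensv !coefsM mulr_suml; apply: eq_bigr => a _.
rewrite mulr_sumr; apply: eq_bigr => b _.
by rewrite !coefs2_tensv mulrACA.
Qed.

Lemma hcomulM g h : hcomul (g * h) = tmul (hcomul g) (hcomul h).
Proof.
apply: coefs2_inj; apply/ffunP=> -[m n]; rewrite hcomulE coefs2_tmul coefsM.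
rewrite mulr_sumr; apply: eq_bigr => a _.
rewrite (bigD1 a) //= !hcomulE eqxx mul1r (inj_eq (mulgI _)) mulrCA.
rewrite big1 ?addr0 // => b ba.
by rewrite hcomulE eq_sym (negbTE ba) !mul0r.
Qed.

Lemma scalar_inj : injective (fun a : k => a%:A : L).
Proof. exact: (fmorph_inj (in_alg L)). Qed.

Lemma hcounit1 : hcounit 1 = 1.
Proof.
apply: scalar_inj; rewrite hcounitE (bigD1 1%g) //= coefs1 eqxx.
by rewrite big1 ?addr0 ?scale1r // => n /negbTE n1; rewrite coefs1 n1.
Qed.

Lemma hcounitM g h : hcounit (g * h) = hcounit g * hcounit h.
Proof.
apply: scalar_inj; rewrite -[RHS]/(in_alg L _) rmorphM /= !hcounitE.
under eq_bigr => n _ do rewrite coefsM.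
rewrite exchange_big mulr_suml; apply: eq_bigr => m _ /=.
rewrite -mulr_sumr [in RHS](reindex_inj (mulgI m^-1%g)); congr (_ * _).
Qed.

Lemma hantipodel h :
  tlift (fun a b => hantipode a * b) (hcomul h) = (hcounit h : k)%:A.
Proof.
have E n : (fun t => cf (tlift (fun a b => hantipode a * b) t) n) =1
    (fun t => \sum_m cf2 t (m^-1, m^-1 * n)%g).
  apply: tens_ext => [x s t|x s t|u w].
  - by rewrite !(linearP, ffunE).
  - rewrite scaler_sumr -big_split; apply: eq_bigr => m _.
    by rewrite !(linearP, ffunE).
  rewrite tlift_tensv => [|u' x s t|v x s t].
  - by rewrite coefsM; apply: eq_bigr => m _; rewrite coefs2_tensv hantipodeE.
  - by rewrite mulrDr scalerAr.
  - by rewrite linearP mulrDl scalerAl.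
apply: (@coefs_inj _ _ _ _ toM); apply/ffunP=> n.
rewrite E linearZ ffunE coefs1 -mulr_algl hcounitE mulr_suml.
rewrite [RHS](reindex_inj invg_inj); apply: eq_bigr => m _.
by rewrite hcomulE mulrC eq_mulVg1 invgK mulKVg.
Qed.

Lemma hantipoder h :
  tlift (fun a b => a * hantipode b) (hcomul h) = (hcounit h : k)%:A.
Proof.
have E n : (fun t => cf (tlift (fun a b => a * hantipode b) t) n) =1
    (fun t => \sum_m cf2 t (m, (m^-1 * n)^-1)%g).
  apply: tens_ext => [x s t|x s t|u w].
  - by rewrite !(linearP, ffunE).
  - rewrite scaler_sumr -big_split; apply: eq_bigr => m _.
    by rewrite !(linearP, ffunE).
  rewrite tlift_tensv => [|u' x s t|v x s t].
  - by rewrite coefsM; apply: eq_bigr => m _; rewrite coefs2_tensv hantipodeE.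
  - by rewrite linearP mulrDr scalerAr.
  - by rewrite mulrDl scalerAl.
apply: (@coefs_inj _ _ _ _ toM); apply/ffunP=> n.
rewrite E linearZ ffunE coefs1 -mulr_algl hcounitE mulr_suml.
apply: eq_bigr => m _.
by rewrite hcomulE mulrC eq_mulgV1 invgK mulKVg.
Qed.

Definition inv_hopf : hopfAlgebra k :=
  HopfAlgebra hcomulA hcounitl hcounitr hcomul1 hcomulM hcounit1 hcounitM
    hantipodel hantipoder.

Lemma inv_hopf_cocomm : cocommutative inv_hopf.
Proof.
move=> h; apply: coefs2_inj; apply/ffunP=> -[m n].
have E : (fun t => cf2 (tswap t) (m, n)) =1 (fun t => cf2 t (n, m)).
  apply: tens_ext => [x s t|x s t|u w]; try by rewrite !(linearP, ffunE).
  by rewrite tswap_tensv !coefs2_tensv mulrC.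
rewrite E !hcomulE eq_sym; case: (eqVneq m n) => [->|] //.
by rewrite !mul0r.
Qed.

End HopfStructure.

(** * The Hopf Galois structure of a cocycle *)

Section CocycleAction.
Variables (k : fieldType) (L : splittingFieldType k) (N : finGroupType).
Local Notation gal := (gal_of {:L}%VS).
Variables (to : {action gal &-> N}) (toM : acts_by_automorphisms to).
Hypothesis galL : galois 1 {:L}.
Variable G' : {group gal}.
Local Notation H := (inv_ring toM).
Local Notation cf := (coefs toM).
Local Notation K := (subvs_of (fixedField G')).

Definition trace_down (a : L) : K :=
  vsproj (fixedField G') (\sum_(h in G') h a).

Lemma trace_downE a : vsval (trace_down a) = \sum_(h in G') h a.
Proof.
apply: vsprojK; apply/fixedFieldP; rewrite ?memvf // => g gG'.
rewrite rmorph_sum [RHS](reindex_inj (mulIg g)); apply: eq_big => h.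
  by rewrite groupMr.
by rewrite galME.
Qed.

Variable pi : regular_cocycle to G'.

(** The embedding of K that n stands for; by [embE] it does not depend on the
    automorphism picked in the fibre, which is never empty. *)
Definition emb (n : N) (x : K) : L :=
  gal_repr (odflt 1%g [pick g | pi g == n]) (vsval x).

Lemma embE g x : emb (pi g) x = g (vsval x).
Proof.
rewrite /emb; case: pickP => [h /eqP hg | /(_ g)]; last by rewrite eqxx.
have : (h * g^-1)%g \in G' by rewrite -(cocycle_eq toM pi g) mulgKV hg.
have [_ fix_x] := mem_fixedFieldP (subvsP x).
by rewrite -{2}[h](mulgKV g) galME => /fix_x->.
Qed.

Lemma emb1 x : emb 1 x = vsval x.
Proof.
have /eqP<- : pi 1%g == 1%g by rewrite cocycle_eq1 group1.
by rewrite embE gal_id.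
Qed.

(** The cocycle identity says that composing embeddings multiplies their
    labels, up to the action. *)
Lemma gal_emb (g : gal) n x : g (emb n x) = emb (pi g * to n g)%g x.
Proof.
by have [h /eqP<-] := cocycle_surj pi n; rewrite -cocycleM !embE galME.
Qed.

Lemma emb_mul n x y : emb n (x * y) = emb n x * emb n y.
Proof. by have [g /eqP<-] := cocycle_surj pi n; rewrite !embE rmorphM. Qed.

Lemma emb_unit n : emb n 1 = 1.
Proof. by have [g /eqP<-] := cocycle_surj pi n; rewrite !embE !rmorph1. Qed.

Lemma emb_linear n : linear (emb n).
Proof. by move=> a x y; rewrite /emb !linearP. Qed.

Lemma sum_fibre (n : N) g (F : gal -> L) :
  pi g = n -> \sum_(h | pi h == n) F h = \sum_(h in G') F (h * g)%g.
Proof.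
move=> <-; rewrite (reindex_inj (mulIg g)); apply: eq_bigl => h.
exact: (cocycle_eq toM).
Qed.

(** On traces from L a combination of embeddings of K becomes a combination of
    automorphisms of L, to which independence of characters applies. *)
Lemma sum_emb_trace (c : N -> L) a :
  \sum_n c n * emb n (trace_down a) = \sum_g c (pi g) * g a.
Proof.
rewrite [RHS](partition_big pi predT) //=; apply: eq_bigr => n _.
have [g /eqP gn] := cocycle_surj pi n.
rewrite (sum_fibre _ gn) -gn embE trace_downE rmorph_sum mulr_sumr.
apply: eq_bigr => h hG'.
by rewrite galME /= (eqP (_ : pi _ == pi g)) ?(cocycle_eq toM).
Qed.

Lemma emb_independent (c : N -> L) :
  (forall x, \sum_n c n * emb n x = 0) -> forall n, c n = 0.
Proof.
move=> c0 n; have [g /eqP<-] := cocycle_surj pi n; move: g (erefl (predT g)).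
by apply: gal_independent => a _; rewrite -sum_emb_trace.
Qed.

Definition mu_fun (h : H) (x : K) : K :=
  vsproj (fixedField G') (\sum_n cf h n * emb n x).

(** The value lies in K: applying g in G' permutes the terms of the sum, by
    [gal_emb] with pi g = 1 and the invariance of the coefficients. *)
Lemma mu_funE h x : vsval (mu_fun h x) = \sum_n cf h n * emb n x.
Proof.
apply: vsprojK; apply/fixedFieldP; rewrite ?memvf // => g gG'.
rewrite rmorph_sum [RHS](reindex_inj (act_inj to g)); apply: eq_bigr => n _.
rewrite rmorphM /= gal_emb coefs_act.
by move: gG'; rewrite -(cocycle_eq1 pi) => /eqP->; rewrite mul1g.
Qed.

Lemma mu_fun_linear h : linear (mu_fun h).
Proof.
move=> a x y; apply: subvs_inj; rewrite linearP /= !mu_funE.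
rewrite scaler_sumr -big_split; apply: eq_bigr => n _ /=.
by rewrite emb_linear mulrDr scalerAr.
Qed.
HB.instance Definition _ h :=
  GRing.isLinear.Build k K K *:%R (mu_fun h) (mu_fun_linear h).

Definition mu_lfun h : 'End(K) := linfun (mu_fun h).

Lemma mu_lfun_linear : linear mu_lfun.
Proof.
move=> a g h; apply/lfunP=> x; rewrite add_lfunE scale_lfunE !lfunE /=.
apply: subvs_inj; rewrite linearP /= !mu_funE.
rewrite scaler_sumr -big_split; apply: eq_bigr => n _ /=.
by rewrite linearP !ffunE mulrDl scalerAl.
Qed.
HB.instance Definition _ :=
  GRing.isLinear.Build k H 'End(K) *:%R mu_lfun mu_lfun_linear.

Definition mu : 'Hom(inv_hopf toM galL, 'End(K)) := linfun mu_lfun.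

Lemma muE (h : H) x : vsval (mu h x) = \sum_n cf h n * emb n x.
Proof. by rewrite [mu h]lfunE [mu_lfun h x]lfunE mu_funE. Qed.

Lemma mu_action : hopf_action mu.
Proof.
split=> [|g h|h|h x y].
- apply/lfunP=> x; apply: subvs_inj; rewrite id_lfunE /= muE (bigD1 1%g) //=.
  rewrite coefs1 eqxx mul1r emb1 big1 ?addr0 // => n /negbTE n1.
  by rewrite coefs1 n1 mul0r.
- apply/lfunP=> x; apply: subvs_inj; rewrite comp_lfunE /= !muE.
  under eq_bigr => p _ do rewrite coefsM mulr_suml.
  rewrite exchange_big; apply: eq_bigr => m _ /=.
  have [s /eqP<-] := cocycle_surj pi m; rewrite embE muE rmorph_sum mulr_sumr.
  rewrite (reindex_inj (mulgI (pi s))) (reindex_inj (act_inj to s)).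
  by apply: eq_bigr => n _; rewrite mulKg coefs_act rmorphM /= gal_emb mulrA.
- apply: subvs_inj; rewrite muE linearZ /= algid1 hcounitE //.
  by apply: eq_bigr => n _; rewrite emb_unit mulr1.
have E : (fun t => vsval (tlift (fun a b => mu a x * mu b y) t)) =1
    (fun t => \sum_m \sum_n tcoef cf cf t (m, n) * (emb m x * emb n y)).
  apply: tens_ext => [a s t|a s t|u v].
  - by rewrite !linearP.
  - rewrite scaler_sumr -big_split; apply: eq_bigr => m _ /=.
    rewrite scaler_sumr -big_split; apply: eq_bigr => n _ /=.
    by rewrite linearP !ffunE mulrDl scalerAl.
  rewrite tlift_tensv => [|u' a s t|v' a s t].
  - rewrite /= !muE mulr_suml; apply: eq_bigr => m _.
    rewrite mulr_sumr; apply: eq_bigr => n _.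
    by rewrite coefs2_tensv mulrACA.
  - by rewrite linearP add_lfunE scale_lfunE mulrDr scalerAr.
  - by rewrite linearP add_lfunE scale_lfunE mulrDl scalerAl.
apply: subvs_inj; rewrite /= E muE; apply: eq_bigr => m _.
rewrite (bigD1 m) //= hcomulE // eqxx mul1r emb_mul big1 ?addr0 // => n mn.
by rewrite hcomulE // eq_sym (negbTE mn) !mul0r.
Qed.

End CocycleAction.

Section HopfGaloisOfCocycle.
Variables (k : fieldType) (L : splittingFieldType k) (N : finGroupType).
Local Notation gal := (gal_of {:L}%VS).
Variables (to : {action gal &-> N}) (toM : acts_by_automorphisms to).
Hypothesis galL : galois 1 {:L}.
Variable G' : {group gal}.
Local Notation H := (inv_ring toM).
Local Notation cf := (coefs toM).
Local Notation K := (subvs_of (fixedField G')).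

Section OneCocycle.
Variable pi : regular_cocycle to G'.

(** Both sides are the index of G' in the Galois group. *)
Lemma card_regular : #|N| = \dim {: K}.
Proof.
have := card_cocycle toM pi.
rewrite (dim_fixedField [set: gal]%G) (dim_fixedField G').
rewrite [fixedField [set: _]](_ : _ = 1%VS).
  rewrite dimv1 divn1.
  rewrite -{1}(@divnK (\dim (fixedField G')) (\dim {: L})); last first.
    by rewrite field_dimS ?subvf.
  rewrite mulnC; move/eqP; rewrite eqn_pmul2r => [/eqP<-|].
    by rewrite dimvf.
  by rewrite divn_gt0 ?dimvS ?subvf ?adim_gt0.
apply/eqP; rewrite eqEsubv sub1v andbT; apply/subvP=> x.
move=> /mem_fixedFieldP[_ fix_x].
have [|a ->] := gal_fixed_scalar galL (x := x); last by rewrite rpredZ ?mem1v.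
by move=> g; apply: fix_x; rewrite inE.
Qed.

(** A tensor that maps to 0 gives, by independence of the embeddings, an
    L-linear relation between the functions of a k-basis of the invariant ring,
    with coefficients in K; [equivariant_free] makes it trivial. *)
Lemma galois_map_inj : injective (galois_map (mu toM galL pi)).
Proof.
apply: raddf_inj => t t0.
pose u := vbasis {: K}; pose v := vbasis {: H}.
have /freeP freeu : free u := basis_free (vbasisP _).
have /freeP freev : free v := basis_free (vbasisP _).
pose y j : K := \sum_i (t : 'M_(_, _)) i j *: u`_i.
suffices y0 j : y j = 0.
  by apply/matrixP=> i j; rewrite mxE; apply: (freeu _ (y0 j)).
apply: subvs_inj; rewrite [RHS]/=.
apply: (equivariant_free galL (to := to) (u := fun j => cf v`_j)
         (x := fun j => vsval (y j))) j => [j | a av0 | n].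
- by rewrite -limg_coefs memv_img ?memvf.
- apply: freev; apply: (@coefs_inj _ _ _ _ toM).
  rewrite linear0 linear_sum -[RHS]av0.
  by apply: eq_bigr => j _; rewrite linearZ.
move: n; apply: (emb_independent toM (pi := pi)
  (c := fun n => \sum_j vsval (y j) * cf v`_j n)) => x.
have gE : galois_map (mu toM galL pi) t x = \sum_j y j * mu toM galL pi v`_j x.
  rewrite /galois_map /tlift exchange_big sum_lfunE; apply: eq_bigr => j _.
  rewrite sum_lfunE mulr_suml; apply: eq_bigr => i _.
  by rewrite scale_lfunE comp_lfunE lfunE /= scalerAl.
under eq_bigr => n _ do rewrite mulr_suml.
rewrite exchange_big /=; transitivity (vsval (galois_map (mu toM galL pi) t x)).
  rewrite gE linear_sum; apply: eq_bigr => j _ /=.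
  by rewrite muE mulr_sumr; apply: eq_bigr => n _; rewrite mulrA.
by rewrite [galois_map _ t]t0 lfunE.
Qed.

Lemma galois_map_bij : bijective (galois_map (mu toM galL pi)).
Proof.
apply: (bijective_of_dim galois_map_inj).
rewrite dim_tens; rewrite [RHS]dimvf.
have -> : \dim {: H} = #|N| by rewrite -(dim_equivariant to galL) dimvf.
by rewrite card_regular !dimvf.
Qed.

Definition cocycle_structure : hopfGalois K :=
  HopfGalois (@inv_hopf_cocomm _ _ _ _ toM galL) (mu_action toM galL pi)
    galois_map_bij.

End OneCocycle.

Lemma equivariant_separated m n :
  (forall h : H, cf h m = cf h n) -> m = n.
Proof.
move=> cmn; apply/eqP; case: (eqVneq m n) => // mn.
have : forall w, (w == m)%:R - (w == n)%:R = 0 :> L.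
  apply: (equivariant_annihilator (to := to)) => c /(coefs_lift toM) <-.
  under eq_bigr => w _ do rewrite mulrBl.
  rewrite sumrB (bigD1 m) //= [X in _ - X](bigD1 n) //= !eqxx !mul1r cmn.
  rewrite !big1 ?subrr // => w /negbTE->; exact: mul0r.
by move=> /(_ m)/eqP; rewrite eqxx (negbTE mn) subr0 oner_eq0.
Qed.

(** An isomorphism f satisfies f(c) (pi2 s) = c (pi1 s) for every s, by
    independence of characters on traces. As c and f(c) are both equivariant and
    the elements f(c) separate the points of N, the bijection pi1 s |-> pi2 s is
    equivariant. *)
Lemma cocycle_structure_iso (pi1 pi2 : regular_cocycle to G') :
    hopfGalois_isomorphic (cocycle_structure pi1) (cocycle_structure pi2) ->
  forall g h h', pi1 h' = to (pi1 h) g -> pi2 h' = to (pi2 h) g.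
Proof.
case=> f [[finv fK finvK] _ _ _] mu_f g h h' pi1_h'.
have coef_f (c : H) s : cf (f c) (pi2 s) = cf c (pi1 s).
  apply/eqP; rewrite -subr_eq0; apply/eqP.
  move: s (erefl (predT s)); apply: gal_independent => a _.
  under eq_bigr => s _ do rewrite mulrBl.
  rewrite sumrB -!(sum_emb_trace toM) -!muE.
  by apply/eqP; rewrite subr_eq0 -(mu_f c).
apply: equivariant_separated => d; rewrite -(finvK d).
by rewrite coef_f pi1_h' !coefs_act coef_f.
Qed.

Lemma cocycle_structure_hopf (pi1 pi2 : regular_cocycle to G') :
  hopf_isomorphic (hg_hopf (cocycle_structure pi1))
    (hg_hopf (cocycle_structure pi2)).
Proof.
exists (id_ahom _); split=> [|h|h|h]; rewrite ?id_lfunE //.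
- by exists id => h; rewrite id_lfunE.
- rewrite -[LHS]/(idfun _); apply: tens_ext => [x s t|x s t|u v] //.
    by rewrite linearP.
  by rewrite tmap_tensv !id_lfunE.
Qed.

End HopfGaloisOfCocycle.

(** * Two cocycles on the symmetric group of degree four *)

Local Close Scope ring_scope.

Section SymmetricGroupFour.
Local Open Scope nat_scope.
Local Open Scope group_scope.

(** The booleans under a name of their own, to carry a group law. *)
Definition xor_bool := bool.
HB.instance Definition _ := Finite.on xor_bool.
HB.instance Definition _ :=
  Finite_isGroup.Build xor_bool addbA addFb addbb.

Local Notation vec := (xor_bool * xor_bool * xor_bool)%type.

(** A subset of {0,1,2,3} is taken up to complement, so it has a unique
    representative without 0, encoded by its characteristic triple on 1, 2, 3;
    [vertex i] is the class of the singleton of i. *)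
Definition vertex (i : nat) : vec :=
  match i with
  | 0 => (true, true, true)
  | 1 => (true, false, false)
  | 2 => (false, true, false)
  | _ => (false, false, true)
  end.

(** A permutation is encoded by the list of its values on 0, 1, 2, 3, so that
    the identities below are finite computations. *)
Definition code_act (v : vec) (s : seq nat) : vec :=
  let: (a, b, c) := v in
  let term (x : bool) i := if x then vertex (nth 0 s i) else 1 in
  term a 1%N * term b 2 * term c 3.

Definition code_odd (s : seq nat) : bool :=
  odd (count (fun ij => nth 0 s ij.2 < nth 0 s ij.1)
             [:: (0, 1); (0, 2); (0, 3); (1, 2); (1, 3); (2, 3)])%N.

(** Multiplication by a primitive cube root of unity of the field of four
    elements, whose nonzero elements 1, w, w^2 are numbered 1, 2, 3. *)
Definition turn (b : bool) (i : nat) : nat :=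
  nth i (if b then [:: 0; 2; 3; 1] else [:: 0; 3; 1; 2])%N i.

Definition code_cocycle (b : bool) (s : seq nat) : vec :=
  let i := turn b (nth 0 s 0) in
  if code_odd s then vertex i else vertex 0 * vertex (turn b i).

Definition code_comp (s t : seq nat) := [seq nth 0 s i | i <- t].

Definition codes := permutations (iota 0 4).

Lemma code_actM v w s : s \in codes ->
  code_act (v * w) s = code_act v s * code_act w s.
Proof.
suffices /allP H : all (fun s =>
    code_act (v * w) s == code_act v s * code_act w s) codes by move=> /H/eqP.
by case: v w => [[[] []] []] [[[] []] []]; vm_compute.
Qed.

Lemma code_act1 v : code_act v (iota 0 4) = v.
Proof. by case: v => [[[] []] []]. Qed.

Lemma code_act_comp v s t : s \in codes -> t \in codes ->
  code_act v (code_comp s t) = code_act (code_act v t) s.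
Proof.
suffices /allP H : all (fun s => all (fun t =>
    code_act v (code_comp s t) == code_act (code_act v t) s) codes) codes.
  by move=> /H/allP Hs /Hs/eqP.
by case: v => [[[] []] []]; vm_compute.
Qed.

Lemma code_cocycle_comp b s t : s \in codes -> t \in codes ->
  code_cocycle b (code_comp s t) =
  code_cocycle b s * code_act (code_cocycle b t) s.
Proof.
suffices /allP H : all (fun s => all (fun t => code_cocycle b (code_comp s t) ==
    code_cocycle b s * code_act (code_cocycle b t) s) codes) codes.
  by move=> /H/allP Hs /Hs/eqP.
by case: b; vm_compute.
Qed.

Lemma code_cocycle_surj b v : exists2 s, s \in codes & code_cocycle b s == v.
Proof.
suffices /hasP : has (fun s => code_cocycle b s == v) codes by [].
by case: b; case: v => [[[] []] []]; vm_compute.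
Qed.

Lemma code_cocycle_kernel b s : s \in codes ->
  (code_cocycle b s == 1) = (code_cocycle true s == 1).
Proof.
suffices /allP H : all (fun s =>
    (code_cocycle b s == 1) == (code_cocycle true s == 1)) codes.
  by move=> sP; rewrite (eqP (H s sP)).
by case: b; vm_compute.
Qed.

Implicit Types p q : 'S_4.

Definition code p : seq nat := [seq val (p i) | i <- enum 'I_4].

Lemma nth_code p (i : 'I_4) : nth 0 (code p) i = p i.
Proof. by rewrite (nth_map ord0) ?size_enum_ord // nth_ord_enum. Qed.

Lemma code_mem p : code p \in codes.
Proof.
rewrite mem_permutations -val_enum_ord /code map_comp perm_map //.
apply: uniq_perm => [||i].
- by rewrite (map_inj_uniq perm_inj) enum_uniq.
- exact: enum_uniq.
rewrite mem_enum; apply/mapP; exists (p^-1 i); first by rewrite mem_enum.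
by rewrite permKV.
Qed.

Lemma codeM p q : code (p * q) = code_comp (code q) (code p).
Proof.
rewrite /code_comp -map_comp; apply: eq_map => i /=.
by rewrite nth_code permM.
Qed.

Lemma code1 : code 1 = iota 0 4.
Proof. by rewrite -val_enum_ord; apply: eq_map => i; rewrite perm1. Qed.

Lemma code_surj s : s \in codes -> exists p, code p = s.
Proof.
rewrite mem_permutations => sP.
have sz : size s = 4 by rewrite (perm_size sP).
have lt4 (i : 'I_4) : nth 0 s i < 4.
  have : nth 0 s i \in iota 0 4 by rewrite -(perm_mem sP) mem_nth ?sz.
  by rewrite mem_iota.
have inj : injective (fun i => Ordinal (lt4 i)).
  move=> i j [/eqP]; rewrite nth_uniq ?sz // ?(perm_uniq sP) ?iota_uniq //.
  by move/eqP/val_inj.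
exists (perm inj); apply: (@eq_from_nth _ 0).
  by rewrite size_map size_enum_ord sz.
move=> i; rewrite size_map size_enum_ord => i4.
by rewrite -[i]/(val (Ordinal i4)) nth_code permE.
Qed.

Definition vec_to v p := code_act v (code p).

Lemma vec_to1 : vec_to^~ 1 =1 id.
Proof. by move=> v; rewrite /vec_to code1 code_act1. Qed.

Lemma vec_toM v : act_morph vec_to v.
Proof. by move=> p q; rewrite /vec_to codeM code_act_comp ?code_mem. Qed.

Definition vec_act := TotalAction vec_to1 vec_toM.

Lemma vec_automorphisms : acts_by_automorphisms vec_act.
Proof. by move=> p v w; apply/code_actM/code_mem. Qed.

(** This kernel is the stabiliser of 0 in the alternating group. *)
Definition rotations := [set p | code_cocycle true (code p) == 1].

Lemma S4_cocycleM b p q : code_cocycle b (code (q * p)) =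
  code_cocycle b (code p) * vec_act (code_cocycle b (code q)) p.
Proof. by rewrite codeM code_cocycle_comp ?code_mem. Qed.

Lemma rotation_group_set : group_set rotations.
Proof.
apply/group_setP; split=> [|p q]; first by rewrite inE code1.
rewrite !inE => /eqP p1 /eqP q1; rewrite S4_cocycleM p1 q1 mul1g.
by rewrite (autact1 vec_automorphisms).
Qed.

Definition rotation_group := Group rotation_group_set.

Lemma S4_cocycle_surj b v : exists p, code_cocycle b (code p) == v.
Proof.
have [s /code_surj[p <-] sv] := code_cocycle_surj b v; by exists p.
Qed.

Lemma S4_cocycle_eq1 b p :
  (code_cocycle b (code p) == 1) = (p \in rotation_group).
Proof. by rewrite inE code_cocycle_kernel ?code_mem. Qed.

Definition S4_cocycle b : regular_cocycle vec_act rotation_group :=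
  RegularCocycle (S4_cocycleM b) (S4_cocycle_surj b) (S4_cocycle_eq1 b).

Lemma card_rotation_group : #|rotation_group| = 3.
Proof.
have := card_cocycle vec_automorphisms (S4_cocycle true).
rewrite cardsT card_Sn !card_prod !card_bool => card24.
by apply/eqP; rewrite -(eqn_pmul2l (isT : 0 < 2 * 2 * 2)%N) -card24.
Qed.

Lemma S4_cocycles_differ : exists p q r,
  S4_cocycle true r = vec_act (S4_cocycle true q) p /\
  S4_cocycle false r <> vec_act (S4_cocycle false q) p.
Proof.
(* With p = (2 3), q = (0 1) and r = (0 2 3 1), the first cocycle sends q and r
   to {2} and {3}, which p exchanges, the second one to {3} and {1}. *)
have [p pE] := @code_surj [:: 0; 1; 3; 2]%N isT.
have [q qE] := @code_surj [:: 1; 0; 2; 3]%N isT.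
have [r rE] := @code_surj [:: 2; 0; 3; 1]%N isT.
by exists p, q, r; rewrite /= /vec_to pE qE rE.
Qed.

Lemma card3_conjugate (P Q : {group 'S_4}) :
  #|P| = 3 -> #|Q| = 3 -> exists x, Q :=: P :^ x.
Proof.
have syl (R : {group 'S_4}) : #|R| = 3 -> 3.-Sylow([set: 'S_4]) R.
  by move=> oR; rewrite pHallE subsetT oR cardsT card_Sn p_part; vm_compute.
move=> /syl sylP /syl sylQ; have [x _ QE] := Sylow_trans sylP sylQ.
by exists x.
Qed.

End SymmetricGroupFour.

Lemma gal_base (k : fieldType) (L : splittingFieldType k) :
  'Gal({:L} / 1)%g = [set: gal_of {:L}%VS].
Proof.
by apply/setP=> g; rewrite inE gal_kHom ?sub1v // k1AHom.
Qed.

Theorem mainTheorem1 (k : fieldType) (Kt : splittingFieldType k)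
    (galKt : galois 1%VS {:Kt}%VS)
    (isoG : 'Gal({:Kt} / 1%VS)%g \isog [set: 'S_4])
    (G' : {group gal_of {:Kt}%VS})
    (sG'G : (G' \subset 'Gal({:Kt} / 1%VS)%g))
    (oG' : #|G'| = 3) :
  exists X X' : hopfGalois (subvs_of (fixedField G')),
    ~ hopfGalois_isomorphic X X' /\ hopf_isomorphic (hg_hopf X) (hg_hopf X').
Proof.
have inG (g : gal_of {:Kt}%VS) : g \in 'Gal({:Kt} / 1%VS)%g.
  by rewrite gal_base inE.
(* The model cocycles are pulled back along an isomorphism onto 'S_4, followed
   by a conjugation that carries the image of G' to the model subgroup. *)
have [f0 inj_f0 im_f0] := isogP isoG.
have [x rotE] : exists x, rotation_group :=: ((f0 @* G') :^ x)%g.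
  by apply: card3_conjugate; rewrite ?card_rotation_group ?card_injm.
pose f g := (f0 g ^ x)%g.
have fM : {morph f : g h / (g * h)%g} by move=> g h; rewrite /f morphM ?conjMg.
have f_surj p : exists g, f g = p.
  have : (p ^ x^-1)%g \in (f0 @* 'Gal({:Kt} / 1%VS))%g by rewrite im_f0 inE.
  by case/morphimP=> g _ _ pE; exists g; rewrite /f -pE conjgKV.
have f_mem g : (f g \in rotation_group) = (g \in G').
  rewrite -[_ \in rotation_group]/(_ \in (rotation_group : {set _})) rotE.
  rewrite memJ_conjg.
  apply/idP/idP => [/morphimP[h _ hG' /(injmP inj_f0)->] | gG'] //.
  exact: mem_morphim.
pose pi b := pull_cocycle fM f_surj f_mem (S4_cocycle b).
have autP := pull_automorphisms fM vec_automorphisms.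
exists (cocycle_structure autP galKt (pi true)).
exists (cocycle_structure autP galKt (pi false)).
split; last exact: cocycle_structure_hopf.
move=> /cocycle_structure_iso iso.
have [p [q [r [eq_t neq_f]]]] := S4_cocycles_differ.
have [[g gp] [h hq] [h' hr]] := And3 (f_surj p) (f_surj q) (f_surj r).
apply: neq_f; have := iso g h h'.
by rewrite /= /pull_to gp hq hr; apply.
Qed.
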